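(* Let $N\ge5$ and let $\theta_1,\dots,\theta_N\in(0,\pi)$ with $\sum_k\theta_k=2\pi$ satisfy $$\frac{\sin(\varphi_N-\varphi_k)}{\sin(\varphi_N-\varphi_j)}\frac{\sin(\varphi_{N-1}-\varphi_j)}{\sin(\varphi_{N-1}-\varphi_k)}\in\mathbb{Q}\cup\{\infty\}\quad\text{for all }1\le j,k\le N-2.$$ Then the counting function $\Theta_{Q,\chi}(\bm z;\tau)$ converges compactly.
   Context: $\varphi_k:=\theta_1+\dots+\theta_k$. For $1\le j\le N-2$: $v_j:=-\frac{\sin(\varphi_N-\varphi_j)}{\sin\theta_N}$, $w_j:=\frac{\sin(\varphi_{N-1}-\varphi_j)}{\sin\theta_N}$. For $\bm\lambda\in\mathbb{R}^{N-2}$: $\lambda_{N-1}:=\sum_jv_j\lambda_j$, $\lambda_N:=\sum_jw_j\lambda_j$. $A_{jk}=\sin(\theta_N)v_{\min(j,k)}w_{\max(j,k)}$, $Q(\bm\lambda)=\frac12\bm\lambda^TA\bm\lambda$ (signed area), $B(\bm a,\bm b)=\bm a^TA\bm b$. With $H(t)=1$ for $t>0$ and $0$ otherwise, $\chi(\bm\lambda):=\prod_{k=1}^NH(\lambda_k)-(-1)^N\prod_{k=1}^NH(-\lambda_k)$. Lattice normalization (suppressed from notation in the paper): fix nonzero $\varepsilon_1,\dots,\varepsilon_N$, $S=\mathrm{diag}(\varepsilon_1,\dots,\varepsilon_{N-2})$, such that the $2\times(N-2)$ matrix with rows $(v_j\varepsilon_j/\varepsilon_{N-1})_j$ and $(w_j\varepsilon_j/\varepsilon_N)_j$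 is integral and primitive and $S^TAS$ is integral (possible under the rationality hypothesis). For $\tau=u+iv\in\mathbb{H}$, $q=e^{2\pi i\tau}$, $\bm z=\bm x+i\bm y\in\mathbb{C}^{N-2}$: $\Theta_{Q,\chi}(\bm z;\tau):=\sum_{\bm n\in\mathbb{Z}^{N-2}}\chi\big(S(\bm n+\bm y/v)\big)q^{Q(S\bm n)}e^{2\pi iB(S\bm n,S\bm z)}$ (a sum over convex polygons with the fixed angles).
   Formalization: Compact convergence on all (z,τ) fails when two edges are antiparallel (e.g. regular hexagon near z=0); proved instead: convergence at every (z,τ), and compact convergence where no S(n+y/v) has all sides zero except possibly one antiparallel pair (all (z,τ) if there is no such pair). *)

(* Defs.v *)
From HB Require Import structures.
From mathcomp Require Import all_boot all_order all_algebra finmap.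
From mathcomp Require Import complex.
From mathcomp Require Import all_classical all_reals all_analysis.
From mathcomp Require Export summability.
Set Implicit Arguments.
Unset Strict Implicit.
Unset Printing Implicit Defensive.
Import Order.TTheory GRing.Theory Num.Theory.
Import numFieldNormedType.Exports.

Local Open Scope classical_set_scope.
Local Open Scope ring_scope.
Local Open Scope complex_scope.

(* Families theta_1, ..., theta_N and eps_1, ..., eps_N are functions on nat of
   which only the values at 1, ..., N matter. A vector of dimension N - 2 is
   indexed by 'I_(N - 2), so its j-th entry (j counted from 0) carries the
   1-based index j.+1. *)

Section Polygons.
Variables (R : realType) (N : nat) (theta : nat -> R).

Definition phi (k : nat) : R := \sum_(1 <= i < k.+1) theta i.

Definition vcoef (j : nat) : R := - (sin (phi N - phi j) / sin (theta N)).

Definition wcoef (j : nat) : R := sin (phi N.-1 - phi j) / sin (theta N).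

(* p / q lies in QQ or is infinite. For the cross-ratios below, numerator and
   denominator vanish together only if j = k, where the cross-ratio is 1. *)
Definition rat_or_infty (p q : R) : Prop :=
  q = 0 \/ exists r : rat, p / q = ratr r.

Definition rational_angles : Prop := forall j k : nat,
  (1 <= j <= N - 2)%N -> (1 <= k <= N - 2)%N ->
  rat_or_infty (sin (phi N - phi k) * sin (phi N.-1 - phi j))
               (sin (phi N - phi j) * sin (phi N.-1 - phi k)).

(* The k-th side length lambda_k, for 1 <= k <= N. *)
Definition side (l : 'cV[R]_(N - 2)) (k : nat) : R :=
  if insub k.-1 is Some j then l j 0
  else if k == N.-1 then \sum_(j < N - 2) vcoef j.+1 * l j 0
  else \sum_(j < N - 2) wcoef j.+1 * l j 0.

Definition area_mx : 'M[R]_(N - 2) :=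
  \matrix_(j, k) (sin (theta N) * vcoef (minn j k).+1 * wcoef (maxn j k).+1).

Definition areaQ (l : 'cV[R]_(N - 2)) : R := (l^T *m area_mx *m l) 0 0 / 2.

(* The C-bilinear extension of B(a, b) = a^T A b. *)
Definition areaB (a b : 'cV[R[i]]_(N - 2)) : R[i] :=
  (a^T *m map_mx (real_complex R) area_mx *m b) 0 0.

Definition heaviside (t : R) : R := if 0 < t then 1 else 0.

Definition chi (l : 'cV[R]_(N - 2)) : R :=
  \prod_(1 <= k < N.+1) heaviside (side l k)
  - (-1) ^+ N * \prod_(1 <= k < N.+1) heaviside (- side l k).

(* The k-th edge points in the direction phi k, so edges a < b are antiparallel
   exactly when phi b - phi a = pi. A degenerate l is a closed polygon collapsed
   onto a line: only two antiparallel sides may be nonzero (possibly none is). *)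
Definition degenerate (l : 'cV[R]_(N - 2)) : Prop :=
  exists a b : nat, [/\ (1 <= a < b)%N, (b <= N)%N, phi b - phi a = pi &
    forall k : nat, (1 <= k <= N)%N -> k != a -> k != b -> side l k = 0].

Section Lattice.
Variable eps : nat -> R.

Definition scale_mx : 'M[R]_(N - 2) := diag_mx (\row_j eps j.+1).

Definition closing_mx : 'M[R]_(2, N - 2) := \matrix_(i, j)
  (if i == 0 then vcoef j.+1 * eps j.+1 / eps N.-1
   else wcoef j.+1 * eps j.+1 / eps N).

Definition primitive_mx m n (M : 'M[int]_(m, n)) : Prop :=
  forall d : int, (forall i j, (d %| M i j)%Z) -> d \is a GRing.unit.

Definition lattice_normalized : Prop :=
  [/\ forall k : nat, (1 <= k <= N)%N -> eps k != 0,
      exists2 M : 'M[int]_(2, N - 2), closing_mx = map_mx intr M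
                                    & primitive_mx M
    & exists G : 'M[int]_(N - 2),
        scale_mx^T *m area_mx *m scale_mx = map_mx intr G].

Definition cexp (s : R[i]) : R[i] :=
  (expR (complex.Re s) * cos (complex.Im s))
  +i* (expR (complex.Re s) * sin (complex.Im s)).

(* S n and S (n + y / v), where y = Im z and v = Im tau. *)
Definition lattice_pt (n : 'cV[int]_(N - 2)) : 'cV[R]_(N - 2) :=
  scale_mx *m map_mx intr n.

Definition shifted_pt (z : 'cV[R[i]^o]_(N - 2)) (tau : R[i]^o)
    (n : 'cV[int]_(N - 2)) : 'cV[R]_(N - 2) :=
  scale_mx *m (map_mx intr n
               + (complex.Im tau)^-1 *: map_mx (@complex.Im R) z).

(* q ^ Q means exp (2 pi i tau Q). *)
Definition Theta_term (z : 'cV[R[i]^o]_(N - 2)) (tau : R[i]^o)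
    (n : 'cV[int]_(N - 2)) : R[i]^o :=
  (chi (shifted_pt z tau n))%:C
  * cexp (2 * pi%:C * 'i * tau * (areaQ (lattice_pt n))%:C)
  * cexp (2 * pi%:C * 'i
          * areaB (map_mx (real_complex R) (lattice_pt n))
                  (map_mx (real_complex R) scale_mx *m z)).

Definition Theta_partial (A : {fset 'cV[int]_(N - 2)})
    (p : 'cV[R[i]^o]_(N - 2) * R[i]^o) : R[i]^o :=
  partial_sum (Theta_term p.1 p.2) A.

Definition Theta (p : 'cV[R[i]^o]_(N - 2) * R[i]^o) : R[i]^o :=
  lim (Theta_partial A p @[A --> totally]).

(* The points (z, tau) with tau in the upper half-plane at which no lattice
   translate S (n + y / v) is degenerate. If no two edges are antiparallel this
   is all of CC^(N-2) x HH. At the excluded points the isotropic vector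
   supported on an antiparallel pair of sides makes the tails of the series
   unbounded on every neighbourhood. *)
Definition regular_domain : set ('cV[R[i]^o]_(N - 2) * R[i]^o) :=
  [set p | 0 < complex.Im p.2 /\
    forall n : 'cV[int]_(N - 2), ~ degenerate (shifted_pt p.1 p.2 n)].

End Lattice.
End Polygons.

(* Main.v *)
Require Import Defs.
From HB Require Import structures.
From mathcomp Require Import all_boot all_order all_algebra finmap.
From mathcomp Require Import complex.
From mathcomp Require Import all_classical all_reals all_analysis.
From mathcomp Require Import ring lra zify.
Import Order.TTheory GRing.Theory Num.Theory.
Import numFieldNormedType.Exports.

Local Open Scope classical_set_scope.
Local Open Scope ring_scope.
Local Open Scope complex_scope.

Set Implicit Arguments.
Unset Strict Implicit.
Unset Printing Implicit Defensive.

(** Write [l = S (n + y / v)]. A term of the series has modulus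
    [|chi l| exp (2 pi v (Q (S y / v) - Q l))], and [chi l] vanishes unless [l]
    or [- l] has only positive sides, so everything rests on a lower bound for
    the area of a convex polygon. Fanning the polygon out from any vertex shows
    [2 Q l >= lambda_p lambda_q |sin (phi_q - phi_p)|] for any two sides. Hence
    [Q l] grows at least linearly in the side [lambda_k] as soon as some side
    that is neither the k-th one nor antiparallel to it is bounded below. The
    normalization confines the k-th side to a translate of [eps_k ZZ], which
    yields such a lower bound at every single point (z, tau), and uniformly near
    each regular one. The series is then dominated by a convergent geometric
    series over the lattice, locally uniformly on the regular domain. *)

(* Sums over finite subsets and the Weierstrass M-test *)
Local Existing Instance totally_filter.

Lemma partial_sumB (I : choiceType) (V : zmodType) (x : I -> V)
    (A B : {fset I}) : (A `<=` B)%fset ->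
  partial_sum x B - partial_sum x A = \sum_(i <- (B `\` A)%fset) x i.
Proof.
move=> AB; rewrite /partial_sum.
rewrite -(big_seq_fsetE _ B xpredT) -(big_seq_fsetE _ A xpredT) /=.
rewrite (big_fsetID _ (mem A) B) /=.
have -> : [fset y in B | y \in A]%fset = A.
  apply/fsetP => i; rewrite !inE /=; case iA : (i \in A); rewrite ?andbF //.
  by rewrite andbT (fsubsetP AB _ iA).
have -> : [fset y in B | y \notin A]%fset = (B `\` A)%fset.
  by apply/fsetP => i; rewrite !inE /= andbC.
by rewrite [X in X - _]addrC addrK.
Qed.

(** The partial sums have a supremum. If [A0] comes within [e] of it, nonnegativity leaves less than
    [e] for whatever lies outside [A0]. *)
Lemma bounded_sum_tail (R : realType) (I : choiceType) (g : I -> R) (M e : R) :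
  (forall i, 0 <= g i) -> (forall A : {fset I}, partial_sum g A <= M) ->
  0 < e -> exists A0 : {fset I}, forall A : {fset I}, (A0 `<=` A)%fset ->
    \sum_(i <- (A `\` A0)%fset) g i < e.
Proof.
move=> g0 gM e0.
have hs : has_sup (range (partial_sum g)).
  split; first by exists (partial_sum g fset0), fset0.
  by exists M => _ [A _ <-].
have [_ [A0 _ <-] hA0] := sup_adherent e0 hs.
exists A0 => A AA; rewrite -partial_sumB // ltrBlDl.
rewrite ltrBlDr in hA0; apply: le_lt_trans hA0.
by apply: ub_le_sup; [exact: hs.2 | exists A].
Qed.

Lemma normc_ge_Im (R : realType) (x : R[i]) : `|complex.Im x|%:C <= `|x|.
Proof.
by case: x => a b; simpc; rewrite -sqrtr_sqr ler_wsqrtr // lerDr sqr_ge0.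
Qed.

Lemma normc_le_ReIm (R : realType) (x : R[i]) :
  `|x| <= (`|complex.Re x| + `|complex.Im x|)%:C.
Proof.
rewrite {1}[x]complexE (le_trans (ler_normD _ _)) // normrM rmorphD /=.
rewrite [ `|'i%C| ]normc_def /= expr0n /= add0r expr1n sqrtr1 mul1r.
by rewrite !normc_def /= !expr0n /= !addr0 !sqrtr_sqr.
Qed.

Lemma cauchy_totally (R : realType) (I : choiceType) (u : {fset I} -> R) :
  (forall e, 0 < e -> exists A0 : {fset I}, forall A : {fset I},
     (A0 `<=` A)%fset -> `|u A0 - u A| < e) ->
  cvg (u A @[A --> totally]).
Proof.
move=> hu; apply: cauchy_cvg; apply: cauchy_exP => e e0.
have [A0 hA0] := hu e e0.
by exists (u A0), A0 => // A AA; apply: hA0.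
Qed.

(** Completeness is applied to the real and imaginary parts separately; each is dominated by the
    modulus, and the modulus by their sum. *)
Lemma cauchy_totallyC (R : realType) (I : choiceType) (u : {fset I} -> R[i]^o) :
  (forall e : R, 0 < e -> exists A0 : {fset I}, forall A : {fset I},
     (A0 `<=` A)%fset -> `|u A0 - u A| < e%:C) ->
  cvg (u A @[A --> totally]).
Proof.
move=> hu.
have cRe : cvg (complex.Re (u A) @[A --> totally]).
  apply: cauchy_totally => e /hu[A0 hA0]; exists A0 => A /hA0.
  rewrite -ltcR; apply: le_lt_trans.
  rewrite (_ : _ - _ = complex.Re (u A0 - u A)) ?normc_ge_Re //.
  by case: (u A0); case: (u A).
have cIm : cvg (complex.Im (u A) @[A --> totally]).
  apply: cauchy_totally => e /hu[A0 hA0]; exists A0 => A /hA0.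
  rewrite -ltcR; apply: le_lt_trans.
  rewrite (_ : _ - _ = complex.Im (u A0 - u A)) ?normc_ge_Im //.
  by case: (u A0); case: (u A).
set a := lim (complex.Re (u A) @[A --> totally]) in cRe.
set b := lim (complex.Im (u A) @[A --> totally]) in cIm.
apply: (cvgP (a +i* b : R[i]^o)).
apply/cvgrPdist_lt => -[e e'].
(* The radius is a complex number; being positive forces its imaginary part to vanish. *)
rewrite ltcE /= => /andP[/eqP -> e0].
have e2 : 0 < e / 2 by rewrite divr_gt0.
have [A0 _ hA0] := (cvgrPdist_lt _ _).1 cRe _ e2.
have [A1 _ hA1] := (cvgrPdist_lt _ _).1 cIm _ e2.
exists (A0 `|` A1)%fset => // A; rewrite /= fsubUset => /andP[AA0 AA1].
apply: (le_lt_trans (normc_le_ReIm _)).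
rewrite ltcR [e]splitr.
have := hA0 _ AA0; have := hA1 _ AA1.
by case: (u A) => x y /= h1 h2; rewrite ltrD.
Qed.

Section WeierstrassM.
Variables (R : realType) (I : choiceType) (T : Type) (f : T -> I -> R[i]^o).
Variables (U : set T) (g : I -> R) (M : R).
Hypothesis fg : forall x i, U x -> `|f x i| <= (g i)%:C.
Hypothesis g0 : forall i, 0 <= g i.
Hypothesis gM : forall A : {fset I}, partial_sum g A <= M.

Let tail (e : R) : 0 < e -> exists A0 : {fset I}, forall A : {fset I},
  (A0 `<=` A)%fset -> forall x, U x ->
  `|partial_sum (f x) A0 - partial_sum (f x) A| < e%:C.
Proof.
move=> e0; have [A0 hA0] := bounded_sum_tail g0 gM e0.
exists A0 => A AA x Ux; rewrite distrC partial_sumB //.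
apply: (le_lt_trans (ler_norm_sum _ _ _)).
apply: (@le_lt_trans _ _ (\sum_(i <- (A `\` A0)%fset) g i)%:C).
  by rewrite rmorph_sum; apply: ler_sum => i _; exact: fg.
by rewrite ltcR hA0.
Qed.

Lemma dominated_cvg x : U x -> cvg (partial_sum (f x) A @[A --> totally]).
Proof.
move=> Ux; apply: cauchy_totallyC => e /tail[A0 hA0].
by exists A0 => A /hA0/(_ x Ux).
Qed.

Lemma dominated_cvg_unif (e : R) : 0 < e ->
  \forall A \near totally, forall x, U x ->
  `|lim (partial_sum (f x) A @[A --> totally]) - partial_sum (f x) A| < e%:C.
Proof.
move=> e0; have e3 : 0 < e / 3 by rewrite divr_gt0.
have [A0 hA0] := tail e3; exists A0 => // A AA x Ux.
have cf := dominated_cvg Ux.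
have e3C : 0 < (e / 3)%:C :> R[i] by rewrite ltcR.
(* [A1] depends on [x], but it only serves as a detour through the union of [A0] and [A1]; the
   threshold [A0] for [A] is the same for all [x]. *)
have [A1 _ hA1] := (cvgrPdist_lt _ _).1 cf _ e3C.
have h1 := hA1 (A0 `|` A1)%fset (fsubsetUr _ _).
have h2 := hA0 (A0 `|` A1)%fset (fsubsetUl _ _) x Ux.
have h3 := hA0 A AA x Ux.
set L := lim _ in h1 *; set s0 := partial_sum _ A0 in h2 h3.
set s1 := partial_sum _ _ in h1 h2; set s := partial_sum _ _ in h3 *.
have -> : L - s = (L - s1) + (s1 - s0) + (s0 - s).
  by rewrite !addrA !subrK.
have -> : e = e / 3 + e / 3 + e / 3 by field.
rewrite !rmorphD /=; apply: (le_lt_trans (ler_normD _ _)).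
rewrite ltrD //; apply: (le_lt_trans (ler_normD _ _)).
by rewrite ltrD // distrC.
Qed.

End WeierstrassM.

(** * A convergent geometric series over the integer lattice *)

Lemma geometric_sum_le (R : realType) (r : R) (m : nat) : 0 <= r < 1 ->
  \sum_(i < m) r ^+ i <= (1 - r)^-1.
Proof.
move=> /andP[r0 r1]; have r1' : 0 < 1 - r by rewrite subr_gt0.
rewrite -(ler_pM2l r1') mulfV ?gt_eqF //.
have := subrX1 r m; move=> h.
rewrite -opprB mulNr -h opprB gerBl; exact: exprn_ge0.
Qed.

(** A finite set of vectors lies in a box, whose points are encoded coordinatewise by a sign and an
    absolute value. The sum over all codes factors into one-dimensional geometric sums. Zero has two
    codes, which is harmless for an upper bound. *)
Lemma int_vector_sum_bounded (R : realType) (d : nat) (r : R) : 0 <= r < 1 ->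
  exists M : R, forall A : {fset 'cV[int]_d},
  partial_sum (fun n : 'cV[int]_d => \prod_(j < d) r ^+ absz (n j 0)) A <= M.
Proof.
move=> r01; have r0 : 0 <= r by case/andP: r01.
set F : 'cV[int]_d -> R := fun n => \prod_(j < d) r ^+ absz (n j 0).
have F0 n : 0 <= F n by apply: prodr_ge0 => j _; exact: exprn_ge0.
exists (\prod_(j < d) (2 * (1 - r)^-1)) => A.
(* A crude common bound for all entries of all vectors in [A]. *)
set m := (\sum_(n : A) \sum_(j < d) absz (val n j ord0))%N.
have le_m (n : A) j : (absz (val n j ord0) < m.+1)%N.
  rewrite ltnS /m (bigD1 n) //= (bigD1 j) //=.
  by rewrite -addnA leq_addr.
pose h (f : {ffun 'I_d -> bool * 'I_m.+1}) : 'cV[int]_d :=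
  \col_j (if (f j).1 then (f j).2%:Z else - (f j).2%:Z).
pose k (n : A) : {ffun 'I_d -> bool * 'I_m.+1} :=
  [ffun j => (0 <= val n j 0, inord (absz (val n j 0)))].
have kK n : h (k n) = val n.
  apply/matrixP => j z; rewrite (ord1 z) mxE ffunE /= inordK ?le_m //.
  case: ifPn => [?|]; first by rewrite gez0_abs.
  by rewrite -ltNge => ?; rewrite ltz0_abs // opprK.
have -> : partial_sum F A = \sum_(f in k @: predT) F (h f).
  rewrite big_imset /=; last by move=> x y _ _ e; apply: val_inj; rewrite -!kK e.
  by apply: eq_bigr => x _; rewrite kK.
apply: (@le_trans _ _ (\sum_f F (h f))).
  by rewrite big_mkcond; apply: ler_sum => f _; case: ifP.
rewrite (eq_bigr (fun f : {ffun 'I_d -> bool * 'I_m.+1} =>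
    \prod_(j < d) r ^+ (f j).2)); last first.
  move=> f _; apply: eq_bigr => j _; rewrite mxE.
  by case: (f j).1; rewrite ?abszN.
(* Distributivity turns the sum over codes into a product over coordinates; the sum over the sign
   gives the factor 2. *)
rewrite -(bigA_distr_bigA (fun (_ : 'I_d) (b : bool * 'I_m.+1) => r ^+ b.2)) /=.
apply: ler_prod => j _; apply/andP; split.
  by apply: sumr_ge0 => b _; exact: exprn_ge0.
rewrite -(pair_big xpredT xpredT (fun (_ : bool) (i : 'I_m.+1) => r ^+ i)) /=.
rewrite big_bool /=; have := geometric_sum_le m.+1 r01.
by set S := \sum_(i < _) _; set c := _^-1; lra.
Qed.

(** * Lower bounds for the area of a convex polygon *)

Lemma sin_le0_pi (R : realType) (x : R) : pi <= x <= 2 * pi -> sin x <= 0.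
Proof.
move=> hx; have := @sin_ge0_pi R (x - pi).
by rewrite sinB cospi sinpi; lra.
Qed.

(* Twice the area of the polygon with edges lam k * exp (i * ph k) is, for
   every m, the sum over the edges of their length times the distance of the
   edge from the m-th vertex; all these distances are nonnegative. *)
Section PolygonArea.
Variables (R : realType) (N : nat) (ph lam : nat -> R).
Hypothesis ph_mono : forall a b : nat, (1 <= a <= b)%N -> (b <= N)%N ->
  0 <= ph b - ph a <= 2 * pi.
Hypothesis lam_ge0 : forall k : nat, (1 <= k <= N)%N -> 0 <= lam k.
Hypothesis closed_ph : forall k : nat, (1 <= k <= N)%N ->
  \sum_(1 <= j < N.+1) lam j * sin (ph j - ph k) = 0.

(** The shoelace formula: the sum of the cross products of all pairs of edges, taken in order. *)
Definition twice_area : R := \sum_(1 <= k < N.+1)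
  lam k * \sum_(1 <= j < k) lam j * sin (ph k - ph j).

Let P k a b : R := \sum_(a <= j < b) lam j * sin (ph j - ph k).

(** [P k] adds up the components of edges normal to the direction [ph k]. The difference is thus the
    signed height of the endpoint of the m-th edge over the line through the k-th edge. *)
Definition vertex_dist k m : R := P k 1 m.+1 - P k 1 k.

Let PD k a b c : (a <= b)%N -> (b <= c)%N -> P k a c = P k a b + P k b c.
Proof. by move=> ab bc; rewrite /P (big_cat_nat ab bc). Qed.

Let P_closed k a b : (1 <= k <= N)%N -> (1 <= a <= b)%N -> (b <= N.+1)%N ->
  P k a b = - P k 1 a - P k b N.+1.
Proof.
move=> hk /andP[a1 ab] bN; have := closed_ph hk; rewrite -/(P k 1 N.+1).
rewrite (PD k a1 (leq_trans ab bN)) (PD k ab bN); lra.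
Qed.

Let P_ge0 k a b : (1 <= a)%N -> (b <= N.+1)%N ->
  (forall j, (a <= j < b)%N -> 0 <= sin (ph j - ph k)) -> 0 <= P k a b.
Proof.
move=> a1 bN h; rewrite /P big_nat; apply: sumr_ge0 => j hj.
by rewrite mulr_ge0 ?h // lam_ge0 //; lia.
Qed.

Let P_le0 k a b : (1 <= a)%N -> (b <= N.+1)%N ->
  (forall j, (a <= j < b)%N -> sin (ph j - ph k) <= 0) -> P k a b <= 0.
Proof.
move=> a1 bN h; rewrite /P big_nat; apply: sumr_le0 => j hj.
by rewrite mulr_ge0_le0 ?h // lam_ge0 //; lia.
Qed.

Let sinBC a b : sin (ph a - ph b) = - sin (ph b - ph a).
Proof. by rewrite -sinN opprB. Qed.

(** Convexity: one walks from the k-th edge to the vertex along the boundary. If the path turns by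
    at most pi, all its edges contribute with the same sign; otherwise [P_closed] replaces it by the
    complementary path, whose edges do. *)
Lemma vertex_dist_ge0 k m : (1 <= k <= N)%N -> (m <= N)%N ->
  0 <= vertex_dist k m.
Proof.
move=> hk mN; have [km|mk] := leqP k m.
  have h1 := ph_mono (a := k) (b := m) ltac:(lia) mN.
  rewrite /vertex_dist (@PD k 1 k m.+1 ltac:(lia) ltac:(lia)) addrAC subrr add0r.
  have [hpi|hpi] := leP (ph m - ph k) pi.
    apply: P_ge0 => [||j hj]; [lia|lia|].
    have h2 := ph_mono (a := k) (b := j) ltac:(lia) ltac:(lia).
    have h3 := ph_mono (a := j) (b := m) ltac:(lia) ltac:(lia).
    by apply: sin_ge0_pi; lra.
  rewrite P_closed; [|lia|lia|lia].
  have : P k 1 k <= 0.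
    apply: P_le0 => [||j hj]; [lia|lia|].
    have h2 := ph_mono (a := j) (b := k) ltac:(lia) ltac:(lia).
    have h3 := ph_mono (a := j) (b := m) ltac:(lia) ltac:(lia).
    by rewrite sinBC oppr_le0; apply: sin_ge0_pi; lra.
  have : P k m.+1 N.+1 <= 0.
    apply: P_le0 => [||j hj]; [lia|lia|].
    have h2 := ph_mono (a := m) (b := j) ltac:(lia) ltac:(lia).
    have h3 := ph_mono (a := k) (b := j) ltac:(lia) ltac:(lia).
    by apply: sin_le0_pi; lra.
  lra.
rewrite /vertex_dist (@PD k 1 m.+1 k ltac:(lia) ltac:(lia)) opprD addrA subrr add0r.
have h1 : (m.+1 < k)%N -> 0 <= ph k - ph m.+1 <= 2 * pi.
  by move=> ?; apply: ph_mono; lia.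
have [hpi|hpi] := leP (ph k - ph m.+1) pi.
  rewrite oppr_ge0; apply: P_le0 => [||j hj]; [lia|lia|].
  have h2 := ph_mono (a := m.+1) (b := j) ltac:(lia) ltac:(lia).
  have h3 := ph_mono (a := j) (b := k) ltac:(lia) ltac:(lia).
  by rewrite sinBC oppr_le0; apply: sin_ge0_pi; lra.
rewrite P_closed; [|lia|lia|lia].
have : 0 <= P k 1 m.+1.
  apply: P_ge0 => [||j hj]; [lia|lia|].
  have h2 := ph_mono (a := j) (b := m.+1) ltac:(lia) ltac:(lia).
  have h3 := ph_mono (a := j) (b := k) ltac:(lia) ltac:(lia).
  by rewrite sinBC oppr_ge0; apply: sin_le0_pi; lra.
have : 0 <= P k k N.+1.
  apply: P_ge0 => [||j hj]; [lia|lia|].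
  have h2 := ph_mono (a := m.+1) (b := j) ltac:(lia) ltac:(lia).
  have h3 := ph_mono (a := k) (b := j) ltac:(lia) ltac:(lia).
  by apply: sin_ge0_pi; lra.
lra.
Qed.

(** The part of the heights that depends on [m] cancels: after exchanging the two sums, each inner
    sum is a closing relation. The rest is the shoelace sum. *)
Lemma twice_areaE m : (m <= N)%N ->
  twice_area = \sum_(1 <= k < N.+1) lam k * vertex_dist k m.
Proof.
move=> mN; rewrite /vertex_dist /twice_area.
have h : \sum_(1 <= k < N.+1) lam k * P k 1 m.+1 = 0.
  under eq_bigr do rewrite /P mulr_sumr.
  rewrite exchange_big_nat /= big_nat big1 // => j hj.
  transitivity (- (lam j *
      \sum_(1 <= k < N.+1) lam k * sin (ph k - ph j))).
    rewrite mulr_sumr -sumrN; apply: eq_bigr => k _.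
    by rewrite (sinBC j k); ring.
  by rewrite closed_ph ?mulr0 ?oppr0 //; lia.
under [RHS]eq_bigr do rewrite mulrBr.
rewrite big_split /= h add0r; apply: eq_bigr => k _.
rewrite -mulrN -sumrN; congr (_ * _); apply: eq_bigr => j _.
by rewrite sinBC mulrN.
Qed.

Lemma twice_area_ge_dist k m : (1 <= k <= N)%N -> (m <= N)%N ->
  lam k * vertex_dist k m <= twice_area.
Proof.
move=> hk mN; rewrite (twice_areaE mN).
rewrite (bigD1_seq k) ?mem_index_iota ?iota_uniq //=.
rewrite lerDl big_seq_cond; apply: sumr_ge0 => j.
rewrite mem_index_iota => /andP[hj _].
by rewrite mulr_ge0 ?lam_ge0 ?vertex_dist_ge0 //; lia.
Qed.

(** The height over the p-th edge is taken at the end of the q-th edge if the turn from p to q is at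
    most pi, and at its start otherwise. Either way it is a sum of nonnegative terms, one of which
    is the height gained along the q-th edge. *)
Lemma twice_area_ge_prod p q : (1 <= p < q)%N -> (q <= N)%N ->
  lam p * lam q * `|sin (ph q - ph p)| <= twice_area.
Proof.
move=> hpq qN.
have lp : 0 <= lam p by apply: lam_ge0; lia.
have h1 := ph_mono (a := p) (b := q) ltac:(lia) qN.
have [hpi|hpi] := leP (ph q - ph p) pi.
  apply: le_trans (@twice_area_ge_dist p q ltac:(lia) qN).
  rewrite -mulrA; apply: ler_wpM2l => //.
  rewrite ger0_norm; last by apply: sin_ge0_pi; lra.
  rewrite /vertex_dist (@PD p 1 p q.+1 ltac:(lia) ltac:(lia)) addrAC subrr add0r.
  rewrite (@PD p p q q.+1 ltac:(lia) ltac:(lia)).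
  rewrite [X in _ <= _ + X]/P big_nat1 lerDr.
  apply: P_ge0 => [||j hj]; [lia|lia|].
  have h2 := ph_mono (a := p) (b := j) ltac:(lia) ltac:(lia).
  have h3 := ph_mono (a := j) (b := q) ltac:(lia) ltac:(lia).
  by apply: sin_ge0_pi; lra.
have qE : q.-1.+1 = q by lia.
apply: le_trans (@twice_area_ge_dist p q.-1 ltac:(lia) ltac:(lia)).
rewrite -mulrA; apply: ler_wpM2l => //.
rewrite ler0_norm; last by apply: sin_le0_pi; lra.
rewrite /vertex_dist qE (@PD p 1 p q ltac:(lia) ltac:(lia)) addrAC subrr add0r.
rewrite P_closed; [|lia|lia|lia].
rewrite (@PD p q q.+1 N.+1 ltac:(lia) ltac:(lia)).
rewrite [P p q _]/P big_nat1 mulrN.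
have : P p 1 p <= 0.
  apply: P_le0 => [||j hj]; [lia|lia|].
  have h2 := ph_mono (a := j) (b := p) ltac:(lia) ltac:(lia).
  have h3 := ph_mono (a := j) (b := q) ltac:(lia) ltac:(lia).
  by rewrite sinBC oppr_le0; apply: sin_ge0_pi; lra.
have : P p q.+1 N.+1 <= 0.
  apply: P_le0 => [||j hj]; [lia|lia|].
  have h2 := ph_mono (a := q) (b := j) ltac:(lia) ltac:(lia).
  have h3 := ph_mono (a := p) (b := j) ltac:(lia) ltac:(lia).
  by apply: sin_le0_pi; lra.
lra.
Qed.

Lemma twice_area_ge0 : (0 < N)%N -> 0 <= twice_area.
Proof.
move=> N0; apply: le_trans (@twice_area_ge_dist N 0 _ _) => //; last by lia.
by rewrite mulr_ge0 ?lam_ge0 ?vertex_dist_ge0 //; lia.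
Qed.

End PolygonArea.

(** * Side lengths, closing relations and the area form *)

Lemma big_nat_recr2 (R : zmodType) (N : nat) (F : nat -> R) : (3 <= N)%N ->
  \sum_(1 <= k < N.+1) F k = \sum_(1 <= k < N.-1) F k + F N.-1 + F N.
Proof.
by case: N => [|[|[|N]]] // _; rewrite (big_nat_recr N.+3) //= big_nat_recr.
Qed.

Section Sides.
Variables (R : realType) (N : nat) (theta : nat -> R).
Hypothesis hN : (5 <= N)%N.
Hypothesis htheta : forall k : nat, (1 <= k <= N)%N -> 0 < theta k < pi.
Hypothesis hsum : \sum_(1 <= k < N.+1) theta k = 2 * pi.

Local Notation phi := (phi theta).
Local Notation vcoef := (vcoef N theta).
Local Notation wcoef := (wcoef N theta).
Local Notation side := (side theta).
Implicit Types l : 'cV[R]_(N - 2).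

Lemma phiB a b : (a <= b)%N -> phi b - phi a = \sum_(a.+1 <= i < b.+1) theta i.
Proof.
by move=> ab; rewrite /phi (@big_cat_nat _ _ _ a.+1 1 b.+1) //= addrAC subrr add0r.
Qed.

Lemma phiB_gt0 a b : (a < b)%N -> (b <= N)%N -> 0 < phi b - phi a.
Proof.
move=> ab bN; rewrite phiB; last exact: ltnW.
rewrite big_nat_recr //= ltr_wpDl //; last by case/andP: (@htheta b ltac:(lia)).
rewrite big_nat; apply: sumr_ge0 => i hi.
by case/andP: (@htheta i ltac:(lia)) => /ltW.
Qed.

Lemma phi_le a b : (a <= b)%N -> (b <= N)%N -> phi a <= phi b.
Proof.
rewrite leq_eqVlt => /predU1P[->//|ab] bN.
by rewrite -subr_ge0 ltW // phiB_gt0.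
Qed.

Lemma phiB_lt2pi a b : (1 <= a)%N -> (a <= b)%N -> (b <= N)%N ->
  phi b - phi a < 2 * pi.
Proof.
move=> a1 ab bN; have phiN : phi N = 2 * pi by [].
have := phi_le bN (leqnn N); have := @phiB_gt0 0 a a1 ltac:(lia).
have -> : phi 0 = 0 by rewrite /Defs.phi big_geq.
by rewrite phiN; lra.
Qed.

Lemma phiB_mono a b : (1 <= a <= b)%N -> (b <= N)%N ->
  0 <= phi b - phi a <= 2 * pi.
Proof.
move=> /andP[a1 ab] bN; rewrite subr_ge0 phi_le //=.
by rewrite ltW // phiB_lt2pi.
Qed.

Lemma phiB_lt_any a b : (1 <= a <= N)%N -> (1 <= b <= N)%N ->
  phi b - phi a < 2 * pi.
Proof.
move=> /andP[a1 aN] /andP[b1 bN]; have [ab|/ltnW ba] := leqP a b.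
  exact: phiB_lt2pi.
by have := phi_le ba aN; have := pi_gt0 R; lra.
Qed.

(** The difference lies strictly between 0 and 2 pi, where the sine vanishes only at pi. *)
Lemma sin_phiB_eq0 a b : (1 <= a < b)%N -> (b <= N)%N ->
  sin (phi b - phi a) = 0 -> phi b - phi a = pi.
Proof.
move=> /andP[a1 ab] bN s0.
have h1 := phiB_gt0 ab bN; have h2 := phiB_lt2pi a1 (ltnW ab) bN.
have [h|h|//] := ltgtP (phi b - phi a) pi.
  by have := @sin_gt0_pi R (phi b - phi a); rewrite s0 ltxx h1 h => /(_ isT).
have := @sin_gt0_pi R (phi b - phi a - pi).
by rewrite sinB sinpi cospi s0 mulr0 mul0r subrr ltxx => /(_ ltac:(lra)).
Qed.

Lemma theta_last : theta N = phi N - phi N.-1.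
Proof.
rewrite phiB; last by lia.
by rewrite (_ : N.-1.+1 = N) ?big_nat1 //; lia.
Qed.

Lemma sin_theta_last_neq0 : sin (theta N) != 0.
Proof. by rewrite gt_eqF // sin_gt0_pi // htheta //; lia. Qed.

Lemma side_ord l (j : 'I_(N - 2)) : side l j.+1 = l j 0.
Proof. by rewrite /Defs.side /= valK. Qed.

Lemma sum_side (F : nat -> R) l :
  \sum_(j < N - 2) F j.+1 * l j 0 = \sum_(1 <= k < N.-1) F k * side l k.
Proof.
rewrite big_add1 (_ : N.-1.-1 = (N - 2)%N); last by lia.
by rewrite big_mkord; apply: eq_bigr => j _; rewrite side_ord.
Qed.

Lemma side_penult l : side l N.-1 = \sum_(1 <= k < N.-1) vcoef k * side l k.
Proof.
rewrite -sum_side {1}/Defs.side insubF ?eqxx //; lia.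
Qed.

Lemma side_last l : side l N = \sum_(1 <= k < N.-1) wcoef k * side l k.
Proof.
rewrite -sum_side {1}/Defs.side insubF; last by lia.
by rewrite ifF //; lia.
Qed.

Lemma sideD l l' k : side (l + l') k = side l k + side l' k.
Proof.
rewrite /Defs.side; case: insubP => [j _ _|_]; first by rewrite mxE.
by case: ifP => _; rewrite -big_split; apply: eq_bigr => j _; rewrite mxE mulrDr.
Qed.

Lemma sideN l k : side (- l) k = - side l k.
Proof.
rewrite /Defs.side; case: insubP => [j _ _|_]; first by rewrite mxE.
by case: ifP => _; rewrite -sumrN; apply: eq_bigr => j _; rewrite mxE mulrN.
Qed.

(** The edge vectors sum to zero, tested against an arbitrary direction: [vcoef] and [wcoef] solve
    the closing equations for the last two sides. For each free side the claim is a three-term sine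
    identity. *)
Lemma side_closed l (psi : R) :
  \sum_(1 <= k < N.+1) side l k * sin (phi k - psi) = 0.
Proof.
have s0 := sin_theta_last_neq0.
rewrite big_nat_recr2 ?(leq_trans _ hN) // side_penult side_last.
rewrite !mulr_suml -!big_split /= big1_seq // => k _.
rewrite /Defs.vcoef /Defs.wcoef; apply: (mulfI s0).
rewrite mulr0 !mulrDr.
have e (x y z : R) : sin (theta N) * (x / sin (theta N) * y * z) = x * y * z.
  by field.
rewrite mulNr !mulNr mulrN !e theta_last !sinB; ring.
Qed.

(** The symmetric matrix is split into a rank-one part, which will produce the product of the last
    two sides, and a strictly triangular part with the entries of the shoelace formula. *)
Lemma area_mxE (j k : 'I_(N - 2)) : area_mx N theta j k =
  sin (theta N) * vcoef j.+1 * wcoef k.+1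
  + (if (k < j)%N then sin (phi j.+1 - phi k.+1) else 0).
Proof.
rewrite mxE; have [kj|jk] := ltnP k j.
  have s0 := sin_theta_last_neq0.
  rewrite /Defs.vcoef /Defs.wcoef; apply: (mulfI s0).
  have e (x y : R) : sin (theta N) * (sin (theta N) * - (x / sin (theta N))
      * (y / sin (theta N))) = - (x * y) by field.
  rewrite mulrDr !e theta_last !sinB; ring.
by rewrite addr0.
Qed.

(** The triangular part of [area_mx] gives the shoelace sum of the first N - 2 edges. The rank-one
    part gives the term of edge N - 1, by the definition of [wcoef]; the term of edge N vanishes
    because the polygon closes. *)
Lemma areaQE l : 2 * areaQ theta l = twice_area N phi (side l).
Proof.
rewrite /areaQ mulrC divfK ?pnatr_eq0 //.
have -> : (l^T *m area_mx N theta *m l) 0 0 =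
  \sum_(k < N - 2) \sum_(j < N - 2) area_mx N theta j k * l j 0 * l k 0.
  rewrite mxE; apply: eq_bigr => k _; rewrite mxE mulr_suml.
  by apply: eq_bigr => j _; rewrite mxE (mulrC (l j 0)).
have -> : \sum_(k < N - 2) \sum_(j < N - 2) area_mx N theta j k * l j 0 * l k 0
  = sin (theta N) * side l N.-1 * side l N
   + \sum_(j < N - 2) (\sum_(1 <= k < j.+1) side l k * sin (phi j.+1 - phi k))
       * l j 0.
  rewrite side_penult side_last -!sum_side -mulrA mulr_suml mulr_sumr.
  rewrite exchange_big -big_split /=; apply: eq_bigr => j _.
  rewrite (_ : \sum_(1 <= k < j.+1) _ = \sum_(k < N - 2 | (k < j)%N)
      l k 0 * sin (phi j.+1 - phi k.+1)); last first.
    rewrite big_add1 /= (big_nat_widen _ _ (N - 2)) ?(ltnW (ltn_ord j)) //.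
    by rewrite big_mkord; apply: eq_big => [k|k _] //; rewrite side_ord.
  rewrite (big_mkcond (fun k : 'I_(N - 2) => (k < j)%N)) mulr_suml.
  rewrite !mulr_sumr -big_split.
  apply: eq_bigr => k _ /=; rewrite area_mxE.
  by case: ifP => _; ring.
rewrite (sum_side (fun j => \sum_(1 <= k < j) side l k * sin (phi j - phi k))).
rewrite /twice_area big_nat_recr2 ?(leq_trans _ hN) //.
have -> : \sum_(1 <= j < N) side l j * sin (phi N - phi j) = 0.
  have := side_closed l (phi N); rewrite big_nat_recr /=; last by lia.
  rewrite subrr sin0 mulr0 addr0 => h.
  apply: oppr_inj; rewrite oppr0 -[RHS]h -sumrN; apply: eq_bigr => j _.
  by rewrite -mulrN -sinN opprB.
rewrite mulr0 addr0 addrC; congr (_ + _).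
  by apply: eq_bigr => k _; rewrite mulrC.
rewrite mulrAC [RHS]mulrC; congr (_ * _); rewrite side_last mulr_sumr.
apply: eq_bigr => k _; rewrite /Defs.wcoef mulrA (mulrC (sin (theta N))).
by rewrite divfK ?sin_theta_last_neq0 // mulrC.
Qed.

Lemma areaQN l : areaQ theta (- l) = areaQ theta l.
Proof.
rewrite /areaQ (_ : (- l)^T = - l^T) ?mulNmx ?mulmxN ?mulNmx ?opprK //.
by apply/matrixP => i j; rewrite !mxE.
Qed.

Lemma areaQ_ge_prod l p q : (forall k, (1 <= k <= N)%N -> 0 <= side l k) ->
  (1 <= p < q)%N -> (q <= N)%N ->
  side l p * side l q * `|sin (phi q - phi p)| <= 2 * areaQ theta l.
Proof.
move=> l0 pq qN; rewrite areaQE; apply: twice_area_ge_prod => //.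
- exact: phiB_mono.
- by move=> k _; exact: side_closed.
Qed.

Lemma areaQ_ge0 l : (forall k, (1 <= k <= N)%N -> 0 <= side l k) ->
  0 <= areaQ theta l.
Proof.
move=> l0; rewrite -(pmulr_rge0 _ (ltr0n _ 2)) areaQE.
apply: twice_area_ge0 => //; last by lia.
- exact: phiB_mono.
- by move=> k _; exact: side_closed.
Qed.

End Sides.

(** * Gaps in translated lattices and linear growth of the area *)

Lemma exists_common_bound (R : realType) (n : nat) (Q : nat -> R -> Prop) :
  (forall i d d', 0 < d' <= d -> Q i d -> Q i d') ->
  (forall i, (i < n)%N -> exists2 d, 0 < d & Q i d) ->
  exists2 d, 0 < d & forall i, (i < n)%N -> Q i d.
Proof.
move=> Qmono; elim: n => [|n IHn] h; first by exists 1.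
have [|d d0 hd] := IHn; first by move=> i ni; apply: h; exact: ltnW.
have [d' d'0 hd'] := h n (ltnSn n).
exists (Num.min d d') => [|i]; first by rewrite lt_min d0.
rewrite ltnS leq_eqVlt => /predU1P[->|ni].
  by apply: Qmono hd'; rewrite lt_min d0 d'0 ge_min lexx orbT.
by apply: Qmono (hd i ni); rewrite lt_min d0 d'0 ge_min lexx.
Qed.

Lemma exists_third_index (N a b : nat) : (1 <= a < b)%N -> (5 <= N)%N ->
  exists j, [/\ (1 <= j <= N)%N, j != a & j != b].
Proof.
move=> ab hN; have [->|a1] := eqVneq a 1%N; last by exists 1%N; split; lia.
have [->|b2] := eqVneq b 2%N; first by exists 3%N; split; lia.
by exists 2%N; split; lia.
Qed.

(** Only the fractional part [f] of [t] matters: the gap is 1 if [f] is 0, and otherwise the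
    distance from [f] to the nearer of 0 and 1. *)
Lemma int_translate_gap (R : realType) (t : R) :
  exists2 d, 0 < d & forall m : int, m%:~R + t = 0 \/ d <= `|m%:~R + t|.
Proof.
pose f := t - (Num.floor t)%:~R.
have f0 : 0 <= f by rewrite subr_ge0 floor_le.
have f1 : f < 1 by rewrite ltrBlDl -[1]/(1%:~R) -intrD floorD1_gt.
have tE m : m%:~R + t = (m + Num.floor t)%:~R + f.
  by rewrite intrD /f; ring.
have [f00|fn0] := eqVneq f 0.
  exists 1 => // m; rewrite tE f00 addr0.
  have [->|mn0] := eqVneq (m + Num.floor t) 0; first by left.
  by right; rewrite -intr_norm ler1z -gtz0_ge1 normr_gt0.
have fp : 0 < f by rewrite lt_neqAle eq_sym fn0.
exists (Num.min f (1 - f)) => [|m]; first by rewrite lt_min fp subr_gt0.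
right; rewrite tE; have [m0|m0] := leP 0 (m + Num.floor t).
  have h : 0 <= (m + Num.floor t)%:~R :> R by rewrite ler0z.
  by rewrite ge_min ger0_norm ?lerDr ?h // addr_ge0.
have h : (m + Num.floor t)%:~R <= -1 :> R.
  by rewrite -[-1]/((-1)%:~R) ler_int; lia.
rewrite ge_min; apply/orP; right; rewrite ler0_norm; lra.
Qed.

Lemma scaled_int_translate_gap (R : realType) (e c : R) : e != 0 ->
  exists2 d, 0 < d & forall m : int, e * m%:~R + c = 0 \/ d <= `|e * m%:~R + c|.
Proof.
move=> e0; have [d d0 hd] := int_translate_gap (c / e).
exists (`|e| * d) => [|m]; first by rewrite mulr_gt0 ?normr_gt0.
have -> : e * m%:~R + c = e * (m%:~R + c / e) by field.
case: (hd m) => [->|h]; first by left; rewrite mulr0.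
by right; rewrite normrM ler_pM2l ?normr_gt0.
Qed.

Section Growth.
Variables (R : realType) (N : nat) (theta : nat -> R).
Hypothesis hN : (5 <= N)%N.
Hypothesis htheta : forall k : nat, (1 <= k <= N)%N -> 0 < theta k < pi.
Hypothesis hsum : \sum_(1 <= k < N.+1) theta k = 2 * pi.

Local Notation phi := (phi theta).
Local Notation side := (side theta).
Implicit Types l : 'cV[R]_(N - 2).

Lemma exists_sin_bound : exists2 c : R, 0 < c &
  forall p q, (1 <= p < q)%N -> (q <= N)%N -> phi q - phi p <> pi ->
  c <= `|sin (phi q - phi p)|.
Proof.
pose Q p q (c : R) := (1 <= p < q)%N -> (q <= N)%N -> phi q - phi p <> pi ->
  c <= `|sin (phi q - phi p)|.
have Qm p q d d' : 0 < d' <= d -> Q p q d -> Q p q d'.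
  by move=> /andP[_ dd] h a b c; apply: le_trans dd (h a b c).
have [|p _|c c0 hc] := @exists_common_bound R N.+1
    (fun p c => forall q, (q < N.+1)%N -> Q p q c).
- by move=> p d d' dd h q qN; exact: Qm dd (h q qN).
- apply: exists_common_bound; first exact: Qm.
  (* The value 1 is a default for pairs with vanishing sine; such pairs are antiparallel and hence
     excluded. *)
  move=> q _; exists (if sin (phi q - phi p) == 0 then 1
                     else `|sin (phi q - phi p)|).
    by case: ifPn => // ?; rewrite normr_gt0.
  move=> pq qN hpi; case: ifPn => // /eqP s0; case: hpi.
  exact: (sin_phiB_eq0 (N := N)).
- by exists c => // p q pq qN; apply: hc => //; lia.
Qed.

(** The triangle inequality, by projecting the closed polygon onto the k-th edge: with [psi] equal
    to [phi k - pi / 2] that edge has coefficient 1, the others at least -1. *)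
Lemma side_le_others l k : (forall j, (1 <= j <= N)%N -> 0 <= side l j) ->
  (1 <= k <= N)%N -> side l k <= \sum_(1 <= j < N.+1 | j != k) side l j.
Proof.
move=> l0 hk; have := side_closed hN htheta l (phi k - pi / 2).
rewrite (bigD1_seq k) ?mem_index_iota ?iota_uniq //=.
rewrite opprB addrCA subrr addr0 sin_pihalf mulr1 => /eqP.
rewrite addr_eq0 => /eqP ->; rewrite -sumrN big_seq_cond [leRHS]big_seq_cond.
apply: ler_sum => j; rewrite mem_index_iota => /andP[hj _].
by rewrite -mulrN ler_piMr ?l0.
Qed.

(** If the k-th side has an antiparallel partner, the hypothesis supplies a third side of length at
    least [d], and the product bound is linear in the k-th side. Otherwise the product bound applies
    to every other side; as these together are at least as long as the k-th, the area grows
    quadratically in it. *)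
Lemma areaQ_growth (d : R) : 0 < d -> exists2 c : R, 0 < c & forall l,
  (forall k, (1 <= k <= N)%N -> 0 <= side l k) ->
  (forall a b, (1 <= a < b)%N -> (b <= N)%N -> phi b - phi a = pi ->
     exists j, [/\ (1 <= j <= N)%N, j != a, j != b & d <= side l j]) ->
  forall k, (1 <= k <= N)%N -> c * (side l k - 1) <= areaQ theta l.
Proof.
move=> d0; have [c c0 hc] := exists_sin_bound.
have N0 : 0 < N%:R :> R by rewrite ltr0n; lia.
(* [d] serves the case with an antiparallel partner, [N%:R^-1] the case without. *)
pose e := Num.min d N%:R^-1.
have e0 : 0 < e by rewrite lt_min d0 invr_gt0.
exists (c / 2 * e) => [|l l0 hl k hk]; first by rewrite mulr_gt0 ?divr_gt0.
pose anti a b := phi a - phi b = pi \/ phi b - phi a = pi.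
have prodQ j : (1 <= j <= N)%N -> j != k -> ~ anti j k ->
    c * (side l k * side l j) <= 2 * areaQ theta l.
  move=> hj jk njk.
  wlog: j k hj hk jk njk / (j < k)%N => [hw|lt_jk].
    move: (jk); rewrite neq_ltn => /orP[|] h; first exact: hw.
    rewrite (mulrC (side l k)); apply: hw => //; first by rewrite eq_sym.
    by move=> [?|?]; apply: njk; [right|left].
  apply: le_trans (areaQ_ge_prod hN htheta hsum l0 (p := j) (q := k) _ _); [|lia|lia].
  rewrite mulrC (mulrC (side l j)) ler_wpM2l ?mulr_ge0 ?l0 //.
  by apply: hc => [||h]; [lia|lia|apply: njk; right].
have lk0 : 0 <= side l k := l0 k hk.
have phi_neq i j : (1 <= i <= N)%N -> (1 <= j <= N)%N -> phi i = phi j -> i = j.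
  move=> hi hj eij; have [h|h|//] := ltngtP i j.
    by have := phiB_gt0 hN htheta (a := i) (b := j) h ltac:(lia); rewrite eij subrr ltxx.
  by have := phiB_gt0 hN htheta (a := j) (b := i) h ltac:(lia); rewrite eij subrr ltxx.
have Q0 : 0 <= areaQ theta l := areaQ_ge0 hN htheta hsum l0.
have [[k' [hk' ak']]|nak] :=
    pselect (exists k', (1 <= k' <= N)%N /\ anti k' k).
  have [j [hj jk jk' dj]] : exists j,
      [/\ (1 <= j <= N)%N, j != k, j != k' & d <= side l j].
    have phi_pi a b : (1 <= a <= N)%N -> (1 <= b <= N)%N ->
        phi b - phi a = pi -> (a < b)%N.
      move=> ha hb h; rewrite ltnNge; apply/negP => ba.
      have := phi_le hN htheta ba ltac:(lia); have := pi_gt0 R; lra.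
    case: ak' => h.
      by apply: hl => //; have := phi_pi _ _ hk hk' h; lia.
    have [||j [? ? ? ?]] := hl _ _ _ _ h; [|lia|by exists j].
    by have := phi_pi _ _ hk' hk h; lia.
  (* The antiparallel partner is unique: two partners would have directions equal or 2 pi apart, and
     all differences are below 2 pi. *)
  have naj : ~ anti j k.
    have b1 := phiB_lt_any hN htheta hsum hk' hj.
    have b2 := phiB_lt_any hN htheta hsum hj hk'.
    move=> aj; move: jk'; rewrite (_ : j = k') ?eqxx //.
    apply: phi_neq => //; case: aj ak' => ? [?|?]; lra.
  have h := prodQ j hj jk naj.
  have : e * side l k <= side l k * side l j.
    by rewrite mulrC ler_wpM2l // (le_trans _ dj) // ge_min lexx.
  rewrite -(ler_pM2l c0) => h'.
  have ce : 0 < c * e by rewrite mulr_gt0.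
  have -> : c / 2 * e * (side l k - 1) = (c * (e * side l k) - c * e) / 2 by field.
  lra.
have hsq : c * (side l k * side l k) <= N%:R * (2 * areaQ theta l).
  have := ler_wpM2l lk0 (side_le_others l0 hk).
  rewrite -(ler_pM2l c0) => /le_trans; apply.
  rewrite !mulr_sumr.
  apply: (@le_trans _ _ (\sum_(1 <= j < N.+1 | j != k) 2 * areaQ theta l)).
    rewrite big_seq_cond [leRHS]big_seq_cond; apply: ler_sum => j.
    rewrite mem_index_iota => /andP[hj jk]; apply: prodQ => // ajk.
    by apply: nak; exists j.
  rewrite big_mkcond /=.
  apply: (@le_trans _ _ (\sum_(1 <= j < N.+1) 2 * areaQ theta l)).
    by apply: ler_sum => j _; case: ifP => // _; rewrite mulr_ge0.
  by rewrite sumr_const_nat subn1 [leRHS]mulr_natl.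
have {}hsq : c * (N%:R^-1 * (side l k * side l k)) <= 2 * areaQ theta l.
  by rewrite mulrCA mulrC ler_pdivrMr // [leRHS]mulrC.
have e1 : e <= N%:R^-1 by rewrite ge_min lexx orbT.
have h1 : e * (side l k - 1) <= N%:R^-1 * (side l k * side l k).
  (* The quadratic bound is weakened to a linear one, so that both cases have the same form. *)
  have s1 : side l k - 1 <= side l k * side l k.
    by have := sqr_ge0 (side l k - 1 / 2); rewrite expr2; lra.
  apply: (@le_trans _ _ (e * (side l k * side l k))); first by rewrite ler_pM2l.
  by rewrite ler_wpM2r // mulr_ge0.
move: h1; rewrite -(ler_pM2l c0) => h1.
have -> : c / 2 * e * (side l k - 1) = c * (e * (side l k - 1)) / 2 by field.
lra.
Qed.

End Growth.

(** * Continuity of imaginary parts *)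

Lemma cvg_Im (R : realType) (z : R[i]^o) : complex.Im w @[w --> z] --> complex.Im z.
Proof.
apply/(@cvgrPdist_lt _ _ _ _ (nbhs_filter z)) => e e0.
exists e%:C => [|w]; first by rewrite /= ltcR.
rewrite /= -ltcR; apply: le_lt_trans.
rewrite (_ : _ - _ = complex.Im (z - w)) ?normc_ge_Im //.
by case: (z); case: (w).
Qed.

Lemma cvg_Im_coord (R : realType) m (p0 : 'cV[R[i]^o]_m * R[i]^o) (j : 'I_m) :
  (fun p : 'cV[R[i]^o]_m * R[i]^o => complex.Im (p.1 j 0)) @ p0 -->
  complex.Im (p0.1 j 0).
Proof.
apply: (@cvg_comp _ _ _ (fun p : 'cV[R[i]^o]_m * R[i]^o => p.1 j 0)
  (@complex.Im R) _ (nbhs (p0.1 j 0 : R[i]^o))); last exact: cvg_Im.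
apply: (@cvg_comp _ _ _ (fun p : 'cV[R[i]^o]_m * R[i]^o => p.1)
  (fun z : 'cV[R[i]^o]_m => z j 0) _ (nbhs p0.1)); first exact: cvg_fst.
exact: (@coord_continuous R[i]).
Qed.

Lemma cvg_Im_snd (R : realType) m (p0 : 'cV[R[i]^o]_m * R[i]^o) :
  (fun p : 'cV[R[i]^o]_m * R[i]^o => complex.Im p.2) @ p0 --> complex.Im p0.2.
Proof.
apply: (@cvg_comp _ _ _ (fun p : 'cV[R[i]^o]_m * R[i]^o => p.2)
  (@complex.Im R) _ (nbhs p0.2)); [exact: cvg_snd | exact: cvg_Im].
Qed.

(** * Moduli of the terms and their geometric majorant *)

Lemma norm_cexp (R : realType) (s : R[i]) :
  `|cexp s| = (expR (complex.Re s))%:C.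
Proof.
rewrite normc_def /cexp /= !exprMn -mulrDr cos2Dsin2 mulr1 sqrtr_sqr.
by rewrite ger0_norm // expR_ge0.
Qed.

Lemma Im_mulmx (R : realType) m n p (A : 'M[R]_(m, n)) (B : 'M[R[i]]_(n, p)) :
  map_mx (@complex.Im R) (map_mx (real_complex R) A *m B) =
  A *m map_mx (@complex.Im R) B.
Proof.
apply/matrixP => i j; rewrite !mxE.
rewrite (big_morph (@complex.Im R) (id1 := 0) (op1 := +%R)) //; last by case=> ? ? [].
apply: eq_bigr => k _; rewrite !mxE; case: (B k j) => x y /=.
by rewrite mul0r addr0.
Qed.

Lemma prod_heaviside (R : realType) (m : nat) (f : nat -> R) :
  \prod_(1 <= k < m.+1) heaviside (f k) = 0 \/
  \prod_(1 <= k < m.+1) heaviside (f k) = 1 /\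
    forall k, (1 <= k <= m)%N -> 0 < f k.
Proof.
elim: m => [|m IHm]; first by right; rewrite big_geq //; split => // k; lia.
rewrite big_nat_recr //= {2 4}/heaviside.
case: ifPn => [fm|_]; last by left; rewrite mulr0.
rewrite mulr1; case: IHm => [->|[-> h]]; [by left|right; split=> // k].
move=> /andP[k1]; rewrite leq_eqVlt => /predU1P[->//|km]; apply: h.
by rewrite k1.
Qed.

Section ThetaBound.
Variables (R : realType) (N : nat) (theta eps : nat -> R).
Hypothesis hN : (5 <= N)%N.
Hypothesis htheta : forall k : nat, (1 <= k <= N)%N -> 0 < theta k < pi.
Hypothesis hsum : \sum_(1 <= k < N.+1) theta k = 2 * pi.
Hypothesis heps : forall k : nat, (1 <= k <= N)%N -> eps k != 0.

Local Notation phi := (phi theta).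
Local Notation side := (side theta).
Local Notation areaQ := (areaQ theta).
Implicit Types (l : 'cV[R]_(N - 2)) (z : 'cV[R[i]^o]_(N - 2)) (tau : R[i]^o).
Implicit Types n : 'cV[int]_(N - 2).

Lemma chi_cases l : [\/ chi theta l = 0,
  `|chi theta l| <= 2 /\ (forall k, (1 <= k <= N)%N -> 0 < side l k) |
  `|chi theta l| <= 2 /\ (forall k, (1 <= k <= N)%N -> 0 < side (- l) k)].
Proof.
have bound (x y : R) : (x = 0 \/ x = 1) -> (y = 0 \/ y = 1) ->
    `|x - (-1) ^+ N * y| <= 2.
  move=> hx hy; apply: (le_trans (ler_normB _ _)).
  rewrite normrM normrX normrN1 expr1n mul1r.
  by case: hx => ->; case: hy => ->; rewrite ?normr0 ?normr1; lra.
rewrite /chi; case: (prod_heaviside N (side l)) => [->|[-> hp]].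
  case: (prod_heaviside N (fun k => - side l k)) => [->|[-> hn]].
    by apply: Or31; rewrite mulr0 subrr.
  apply: Or33; split; first by apply: bound; [left|right].
  by move=> k hk; rewrite sideN; exact: hn.
apply: Or32; split=> //; apply: bound; first by right.
by case: (prod_heaviside N (fun k => - side l k)) => [->|[-> _]]; [left|right].
Qed.

Definition shift_pt z tau : 'cV[R]_(N - 2) :=
  scale_mx N eps *m ((complex.Im tau)^-1 *: map_mx (@complex.Im R) z).

Lemma shifted_ptE z tau n :
  shifted_pt eps z tau n = lattice_pt eps n + shift_pt z tau.
Proof. by rewrite /shifted_pt mulmxDr. Qed.

Lemma areaQD (a b : 'cV[R]_(N - 2)) :
  areaQ (a + b) = areaQ a + (a^T *m area_mx N theta *m b) 0 0 + areaQ b.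
Proof.
have sym : (b^T *m area_mx N theta *m a) 0 0 = (a^T *m area_mx N theta *m b) 0 0.
  have tr (x : 'M[R]_1) : x 0 0 = x^T 0 0 by rewrite mxE.
  rewrite [LHS]tr !trmx_mul trmxK mulmxA.
  suff -> : (area_mx N theta)^T = area_mx N theta by [].
  by apply/matrixP => i j; rewrite !mxE minnC maxnC.
rewrite /Defs.areaQ (_ : (a + b)^T = a^T + b^T); last first.
  by apply/matrixP => i j; rewrite !mxE.
rewrite !mulmxDl !mulmxDr.
have e (x y : 'M[R]_1) : (x + y) 0 0 = x 0 0 + y 0 0 by rewrite mxE.
by rewrite !e sym; field.
Qed.

(** Completing the square: for a = S n and b = S y / v the two exponentials have moduli exp (-2 pi v
    Q(a)) and exp (-2 pi v B(a, b)), and Q(a) + B(a, b) = Q(a + b) - Q(b). *)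
Lemma norm_Theta_term z tau n : 0 < complex.Im tau ->
  `|Theta_term theta eps z tau n| =
  (`|chi theta (shifted_pt eps z tau n)| * expR (2 * pi * complex.Im tau *
     (areaQ (shift_pt z tau) - areaQ (shifted_pt eps z tau n))))%:C.
Proof.
move=> v0; rewrite /Theta_term !normrM !norm_cexp -mulrA -rmorphM /= -expRD.
rewrite normc_def /= expr0n addr0 sqrtr_sqr -rmorphM /=.
congr ((_ * expR _)%:C).
set B := areaB _ _ _.
have ImB : complex.Im B = complex.Im tau *
    ((lattice_pt eps n)^T *m area_mx N theta *m shift_pt z tau) 0 0.
  rewrite /B /areaB map_trmx -map_mxM.
  have im (X : 'M[R[i]]_1) : complex.Im (X 0 0) = map_mx (@complex.Im R) X 0 0.
    by rewrite mxE.
  have sc (c : R) (X : 'M[R]_1) : (c *: X) 0 0 = c * X 0 0 by rewrite mxE.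
  rewrite im !Im_mulmx /shift_pt -!scalemxAr sc mulrA mulfV ?gt_eqF //.
  by rewrite mul1r.
rewrite shifted_ptE areaQD.
have -> : 2 = (2 : R)%:C by rewrite rmorph_nat.
have reI (c : R) (s : R[i]) : complex.Re (2%:C * c%:C * 'i * s) =
    - (2 * c * complex.Im s).
  by case: s => x y; simpc.
have -> : complex.Re (2%:C * pi%:C * 'i * tau * (areaQ (lattice_pt eps n))%:C) =
    - (2 * pi * (complex.Im tau * areaQ (lattice_pt eps n))).
  by rewrite -mulrA reI; case: (tau) => x y /=; rewrite mulr0 add0r.
rewrite reI ImB; ring.
Qed.

(* The last clause keeps the polygons quantitatively away from the degenerate
   ones, along which the area is bounded while the perimeter is not. *)
Definition tame (d : R) z tau : Prop :=
  [/\ d <= complex.Im tau <= d^-1,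
      forall j, `|shift_pt z tau j 0| <= d^-1 &
      forall n (l := shifted_pt eps z tau n) a b,
        (1 <= a < b)%N -> (b <= N)%N -> phi b - phi a = pi ->
        (forall k, (1 <= k <= N)%N -> side l k != 0) ->
        exists j, [/\ (1 <= j <= N)%N, j != a, j != b & d <= `|side l j|]].

Lemma areaQ_le l (t : R) : (forall j, `|l j 0| <= t) ->
  areaQ l <= (\sum_k \sum_j `|area_mx N theta j k|) * (t * t).
Proof.
move=> lt; have t0 : 0 <= t.
  have j0 : (0 < N - 2)%N by lia.
  exact: le_trans (normr_ge0 _) (lt (Ordinal j0)).
apply: (le_trans (ler_norm _)); rewrite /Defs.areaQ normrM.
rewrite [X in _ * X]ger0_norm ?invr_ge0 // ler_pdivrMr //.
apply: (@le_trans _ _ ((\sum_k \sum_j `|area_mx N theta j k|) * (t * t))); last first.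
  rewrite -[leLHS]mulr1 ler_wpM2l //; last by lra.
  by rewrite mulr_ge0 ?mulr_ge0 // sumr_ge0 // => k _; rewrite sumr_ge0.
rewrite mxE mulr_suml (le_trans (ler_norm_sum _ _ _)) // ler_sum // => k _.
rewrite normrM mxE mulrA ler_pM ?lt //.
rewrite mulr_suml (le_trans (ler_norm_sum _ _ _)) // ler_sum // => j _.
by rewrite normrM mxE mulrC ler_wpM2l.
Qed.

Lemma lattice_ptE n (j : 'I_(N - 2)) :
  lattice_pt eps n j 0 = eps j.+1 * (n j 0)%:~R.
Proof. by rewrite /lattice_pt /scale_mx mul_diag_mx !mxE. Qed.

(** Where [chi] is nonzero, all sides have one sign and [areaQ_growth] applies to [l] or to [- l].
    Averaged over the N - 2 free sides, it bounds the area below linearly in the sum of the absolute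
    values of the entries of [n], with constants depending only on [d]. *)
Lemma tame_dominated (d : R) : 0 < d -> exists C r : R,
  [/\ 0 <= C, 0 <= r < 1 & forall z tau n, tame d z tau ->
    `|Theta_term theta eps z tau n| <=
      (C * \prod_(j < N - 2) r ^+ absz (n j 0))%:C].
Proof.
move=> d0; have [c c0 hc] := areaQ_growth hN htheta hsum d0.
have [|k kN|e e0 he] := @exists_common_bound R N.+1
  (fun k e => (1 <= k)%N -> e <= `|eps k|).
- by move=> k x y /andP[_ xy] h k1; exact: le_trans xy (h k1).
- have [->|k1] := posnP k; first by exists 1.
  by exists `|eps k|; rewrite // normr_gt0 heps // k1.
set D : R := (N - 2)%:R; have D0 : 0 < D by rewrite ltr0n; lia.
pose A := \sum_k \sum_j `|area_mx N theta j k|.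
have A0 : 0 <= A by rewrite sumr_ge0 // => k _; rewrite sumr_ge0.
(* The first summand bounds the area form at [shift_pt]; the second is the constant lost in the
   lower bound for the area at [l]. *)
pose E := A * (d^-1 * d^-1) + c * (d^-1 + 1).
have di0 : 0 < d^-1 by rewrite invr_gt0.
have E0 : 0 <= E by rewrite addr_ge0 // mulr_ge0 // ?addr_ge0 // ?mulr_ge0 // ltW.
pose x := 2 * pi * d * (c * e / D).
have x0 : 0 < x by rewrite !mulr_gt0 ?invr_gt0 ?pi_gt0.
exists (2 * expR (2 * pi * d^-1 * E)), (expR (- x)); split.
- by rewrite mulr_ge0 ?expR_ge0.
- by rewrite expR_ge0 expR_lt1 oppr_lt0.
move=> z tau n [/andP[v1 v2] hs hl]; have v0 := lt_le_trans d0 v1.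
rewrite norm_Theta_term //.
set l := shifted_pt eps z tau n.
have rhs0 : 0 <= 2 * expR (2 * pi * d^-1 * E) *
    \prod_(j < N - 2) expR (- x) ^+ absz (n j 0).
  by rewrite mulr_ge0 ?mulr_ge0 ?expR_ge0 // prodr_ge0 // => j _;
    rewrite exprn_ge0 ?expR_ge0.
suff Q_ge : (forall k, (1 <= k <= N)%N -> 0 < side l k) \/
    (forall k, (1 <= k <= N)%N -> 0 < side (- l) k) ->
  c * e / D * (\sum_(j < N - 2) (absz (n j 0))%:R) - c * (d^-1 + 1) <= areaQ l.
  rewrite lecR.
  have key : (forall k, (1 <= k <= N)%N -> 0 < side l k) \/
      (forall k, (1 <= k <= N)%N -> 0 < side (- l) k) ->
      expR (2 * pi * complex.Im tau * (areaQ (shift_pt z tau) - areaQ l)) <=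
      expR (2 * pi * d^-1 * E) * \prod_(j < N - 2) expR (- x) ^+ absz (n j 0).
    move=> /Q_ge {}Q_ge.
    under eq_bigr do rewrite -expRM_natl.
    rewrite -expR_sum -expRD ler_expR -mulr_suml mulrN.
    set K := \sum_(j < N - 2) _ in Q_ge *.
    have K0 : 0 <= K by apply: sumr_ge0.
    have hQ : areaQ (shift_pt z tau) - areaQ l <= E - c * e / D * K.
      by have := areaQ_le hs; rewrite -/A /E; lra.
    apply: (@le_trans _ _ (2 * pi * complex.Im tau * (E - c * e / D * K))).
      by rewrite ler_wpM2l // !mulr_ge0 ?pi_ge0 // ltW.
    (* The constant [E] is paired with the upper bound [d^-1] of the imaginary part of [tau], the
       decaying part with its lower bound [d]. *)
    rewrite mulrBr lerB //.
      by rewrite ler_wpM2r // ler_wpM2l // mulr_ge0 ?pi_ge0.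
    rewrite /x mulrC !mulrA ler_wpM2r //.
    by rewrite !ler_pM2r // ?invr_gt0 // ler_wpM2l // mulr_ge0 ?pi_ge0.
  case: (chi_cases l) => [->|[h2 hp]|[h2 hp]].
  - by rewrite normr0 mul0r.
  - by rewrite -[leRHS]mulrA ler_pM ?expR_ge0 ?(key (or_introl hp)).
  - by rewrite -[leRHS]mulrA ler_pM ?expR_ge0 ?(key (or_intror hp)).
have side_n (j : 'I_(N - 2)) : e * (absz (n j 0))%:R - d^-1 <= `|side l j.+1|.
  rewrite side_ord // /l shifted_ptE mxE lattice_ptE.
  apply: le_trans (lerB_normD _ _) => //.
  rewrite normrM; have := hs j.
  have : e * (absz (n j 0))%:R <= `|eps j.+1| * `|(n j 0)%:~R|.
    rewrite -intr_norm -abszE ler_wpM2r // he // ltnS.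
    exact: leq_trans (ltn_ord j) (leq_subr _ _).
  lra.
have side_Q : (forall k, (1 <= k <= N)%N -> 0 < side l k) \/
    (forall k, (1 <= k <= N)%N -> 0 < side (- l) k) ->
    forall k, (1 <= k <= N)%N -> c * (`|side l k| - 1) <= areaQ l.
  case=> hp k hk.
    rewrite gtr0_norm ?hp //; apply: hc => // [j hj|a b h1 h2 h3].
      by rewrite ltW ?hp.
    have [|j [? ? ? hj]] := hl n a b h1 h2 h3.
      by move=> i hi; rewrite gt_eqF // hp.
    by exists j; split=> //; rewrite -[leRHS]gtr0_norm ?hp.
  have sN i : `|side l i| = `|side (- l) i| by rewrite sideN normrN.
  rewrite sN gtr0_norm ?hp // -(areaQN theta).
  apply: hc => // [j hj|a b h1 h2 h3].
    by rewrite ltW ?hp.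
  have [|j [? ? ? hj]] := hl n a b h1 h2 h3.
    by move=> i hi; rewrite -oppr_eq0 -sideN gt_eqF // hp.
  by exists j; split=> //; rewrite -[leRHS]gtr0_norm ?hp // -sN.
move=> /side_Q hQ.
(* Each free side bounds the same area, so summing gives N - 2 times the area, divided out below by
   [D]. *)
have : \sum_(j < N - 2) c * (e * (absz (n j 0))%:R - d^-1 - 1)
    <= \sum_(j < N - 2) areaQ l.
  apply: ler_sum => j _; apply: le_trans (hQ j.+1 _); last first.
    by rewrite /= (leq_trans (ltn_ord j)) // leq_subr.
  by rewrite ler_pM2l // lerD2r.
rewrite sumr_const card_ord -mulr_natl -/D.
rewrite -mulr_sumr sumrB sumrB -mulr_sumr !sumr_const card_ord.
rewrite -[d^-1 *+ _]mulr_natl -/D => h.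
rewrite -(ler_pM2l D0); apply: le_trans h.
set K := \sum_(j < N - 2) _.
rewrite le_eqVlt; apply/orP; left; apply/eqP; rewrite -/D; field.
by rewrite !gt_eqF.
Qed.

(** * Tameness from the lattice normalization *)

Variable M : 'M[int]_(2, N - 2).
Hypothesis hM : closing_mx N theta eps = map_mx intr M.

(** The free sides are lattice coordinates by construction; for the last two, this is the
    integrality of [closing_mx]. *)
Lemma side_lattice k : (1 <= k <= N)%N -> forall n, exists m : int,
  side (lattice_pt eps n) k = eps k * m%:~R.
Proof.
move=> hk n.
have [kN|kN] := ltnP k.-1 (N - 2).
  have -> : k = (Ordinal kN).+1 by rewrite /=; lia.
  by exists (n (Ordinal kN) 0); rewrite side_ord // lattice_ptE.
have eN1 : eps N.-1 != 0 by apply: heps; lia.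
have eN : eps N != 0 by apply: heps; lia.
have [->|->] : k = N.-1 \/ k = N by lia.
  exists (\sum_(j < N - 2) M 0 j * n j 0).
  rewrite side_penult // -sum_side // (rmorph_sum intr) mulr_sumr.
  apply: eq_bigr => j _; rewrite lattice_ptE rmorphM /=.
  have := congr1 (fun X : 'M[R]_(2, N - 2) => X 0 j) hM; rewrite !mxE /= => <-.
  by field.
exists (\sum_(j < N - 2) M 1 j * n j 0).
rewrite side_last // -sum_side // (rmorph_sum intr) mulr_sumr.
apply: eq_bigr => j _; rewrite lattice_ptE rmorphM /=.
have := congr1 (fun X : 'M[R]_(2, N - 2) => X 1 j) hM; rewrite !mxE /= => <-.
by field.
Qed.

(** The k-th side runs through a translate of [eps k] times the integers, whose nonzero elements
    stay away from 0. The bound is uniform in [n], but not in [z] and [tau]. *)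
Lemma side_gap z tau : exists2 d : R, 0 < d & forall k n,
  (1 <= k <= N)%N -> side (shifted_pt eps z tau n) k = 0 \/
                     d <= `|side (shifted_pt eps z tau n) k|.
Proof.
have [|k kN|d d0 hd] := @exists_common_bound R N.+1 (fun k d => forall n,
  (1 <= k <= N)%N -> side (shifted_pt eps z tau n) k = 0 \/
                     d <= `|side (shifted_pt eps z tau n) k|).
- move=> k d d' /andP[_ dd] h n hk; case: (h n hk) => [|h']; first by left.
  by right; exact: le_trans dd h'.
- have [hk|hk] := boolP (1 <= k <= N)%N; last by exists 1.
  have [d d0 hd] :=
    scaled_int_translate_gap (side (shift_pt z tau) k) (heps hk).
  exists d => // n _; rewrite shifted_ptE sideD.
  by have [m ->] := side_lattice hk n.
- by exists d => // k n hk; apply: hd => //; lia.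
Qed.

(** At a single point [tame] concerns only polygons without zero sides, so by [side_gap] any third
    side will do, even where some translate is degenerate. *)
Lemma tame_point z tau : 0 < complex.Im tau -> exists2 d : R, 0 < d & tame d z tau.
Proof.
move=> v0; have [d d0 hd] := side_gap z tau.
set v := complex.Im tau in v0 *.
pose T : R := 1 + \sum_j `|shift_pt z tau j 0|.
have T0 : 0 < T by rewrite ltr_wpDr // sumr_ge0.
pose e := Num.min d (Num.min v (Num.min v^-1 T^-1)).
have e0 : 0 < e by rewrite !lt_min d0 v0 !invr_gt0 v0 T0.
have [e1 e2 e3 e4] : [/\ e <= d, e <= v, e <= v^-1 & e <= T^-1].
  by split; rewrite !ge_min lexx ?orbT.
exists e => //; split.
- by rewrite e2 -[leLHS]invrK lef_pV2 // posrE ?invr_gt0.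
- move=> j; apply: (@le_trans _ _ T).
    by rewrite /T (bigD1 j) //= addrCA lerDl addr_ge0 // sumr_ge0.
  by rewrite -[leLHS]invrK lef_pV2 // posrE ?invr_gt0.
move=> n l a b ab bN _ hl.
have [j [hj ja jb]] := exists_third_index ab hN.
exists j; split=> //.
have [h|h] := hd j n hj; first by have := hl j hj; rewrite h eqxx.
exact: le_trans e1 h.
Qed.

Lemma cvg_shift_pt (p0 : 'cV[R[i]^o]_(N - 2) * R[i]^o) j :
  0 < complex.Im p0.2 ->
  (fun p : 'cV[R[i]^o]_(N - 2) * R[i]^o => shift_pt p.1 p.2 j 0) @ p0
    --> shift_pt p0.1 p0.2 j 0.
Proof.
move=> v0.
have E (p : 'cV[R[i]^o]_(N - 2) * R[i]^o) : shift_pt p.1 p.2 j 0 =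
    eps j.+1 * ((complex.Im p.2)^-1 * complex.Im (p.1 j 0)).
  by rewrite /shift_pt /scale_mx mul_diag_mx !mxE.
rewrite E; have -> : (fun p : 'cV[R[i]^o]_(N - 2) * R[i]^o =>
    shift_pt p.1 p.2 j 0) = fun p => eps j.+1 *
    ((complex.Im p.2)^-1 * complex.Im (p.1 j 0)) by exact/funext.
apply: cvgM; first exact: cvg_cst.
apply: cvgM; last exact: cvg_Im_coord.
by apply: cvgV; [rewrite gt_eqF | exact: cvg_Im_snd].
Qed.

Lemma cvg_side_shift_pt (p0 : 'cV[R[i]^o]_(N - 2) * R[i]^o) k :
  0 < complex.Im p0.2 ->
  (fun p : 'cV[R[i]^o]_(N - 2) * R[i]^o => side (shift_pt p.1 p.2) k) @ p0
    --> side (shift_pt p0.1 p0.2) k.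
Proof.
move=> v0; rewrite /Defs.side; case: insubP => [j _ _|_].
  exact: cvg_shift_pt.
have h c : (fun p : 'cV[R[i]^o]_(N - 2) * R[i]^o =>
      \sum_(j < N - 2) c j * shift_pt p.1 p.2 j 0) @ p0 -->
    \sum_(j < N - 2) c j * shift_pt p0.1 p0.2 j 0.
  apply: (@cvg_big R^o); first exact: (@add_continuous R^o).
  by move=> j _; apply: (cvgM (cvg_cst _)); exact: cvg_shift_pt.
by case: ifP => _; exact: h.
Qed.

(** At a regular [p0] every antiparallel pair leaves some third side nonzero, hence at least [d] by
    [side_gap]. Moving from [p0] to [p] changes this side by an amount independent of [n], so near
    [p0] at least [d / 2] survives for all lattice points at once. *)
Lemma tame_near (p0 : 'cV[R[i]^o]_(N - 2) * R[i]^o) :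
  regular_domain theta eps p0 ->
  exists2 d : R, 0 < d & \forall p \near p0, tame d p.1 p.2.
Proof.
move=> [v0 nondeg]; have [d d0 hd] := side_gap p0.1 p0.2.
set v := complex.Im p0.2 in v0.
pose T : R := 1 + \sum_j `|shift_pt p0.1 p0.2 j 0|.
have T0 : 0 < T by rewrite ltr_wpDr // sumr_ge0.
(* The first two entries give lower bounds; the inverses become the upper bounds [2 * v] and [T] on
   what must stay below [e^-1]. The 1 in [T] leaves room for moving away from [p0]. *)
pose e := Num.min (d / 2) (Num.min (v / 2) (Num.min (2 * v)^-1 T^-1)).
have e0 : 0 < e by rewrite !lt_min ?invr_gt0 ?divr_gt0 ?mulr_gt0.
have [e1 e2 e3 e4] : [/\ e <= d / 2, e <= v / 2, e <= (2 * v)^-1 & e <= T^-1].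
  by split; rewrite !ge_min lexx ?orbT.
exists e => //.
have v20 : 0 < v / 2 by rewrite divr_gt0.
have d20 : 0 < d / 2 by rewrite divr_gt0.
have /cvgrPdist_lt/(_ _ v20) nv := @cvg_Im_snd R _ p0.
have ns : \forall p \near p0, forall j : 'I_(N - 2),
    `|shift_pt p0.1 p0.2 j 0 - shift_pt p.1 p.2 j 0| < 1.
  apply: (@filter_forall _ _ (fun (j : 'I_(N - 2))
      (p : 'cV[R[i]^o]_(N - 2) * R[i]^o) =>
    `|shift_pt p0.1 p0.2 j 0 - shift_pt p.1 p.2 j 0| < 1) (nbhs p0)) => j.
  by have /cvgrPdist_lt/(_ _ ltr01) := @cvg_shift_pt p0 j v0.
have nk : \forall p \near p0, forall k : 'I_N.+1,
    `|side (shift_pt p0.1 p0.2) k - side (shift_pt p.1 p.2) k| < d / 2.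
  apply: (@filter_forall _ _ (fun (k : 'I_N.+1)
      (p : 'cV[R[i]^o]_(N - 2) * R[i]^o) =>
    `|side (shift_pt p0.1 p0.2) k - side (shift_pt p.1 p.2) k| < d / 2)
    (nbhs p0)) => k.
  by have /cvgrPdist_lt/(_ _ d20) := @cvg_side_shift_pt p0 k v0.
near=> p.
have hv : `|v - complex.Im p.2| < v / 2 by near: p; exact: nv.
have hs : forall j : 'I_(N - 2),
  `|shift_pt p0.1 p0.2 j 0 - shift_pt p.1 p.2 j 0| < 1 by near: p; exact: ns.
have hk : forall k : 'I_N.+1,
  `|side (shift_pt p0.1 p0.2) k - side (shift_pt p.1 p.2) k| < d / 2
  by near: p; exact: nk.
move: hv; rewrite ltr_norml => hv; split.
- apply/andP; split; first lra.
  apply: (@le_trans _ _ (2 * v)); first lra.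
  by rewrite -[leLHS]invrK lef_pV2 // posrE ?invr_gt0 ?mulr_gt0.
- move=> j; apply: (@le_trans _ _ T); last first.
    by rewrite -[leLHS]invrK lef_pV2 // posrE ?invr_gt0.
  have -> : shift_pt p.1 p.2 j 0 = shift_pt p0.1 p0.2 j 0
    - (shift_pt p0.1 p0.2 j 0 - shift_pt p.1 p.2 j 0) by ring.
  apply: (le_trans (ler_normB _ _)).
  have := ltW (hs j).
  rewrite /T (bigD1 j) //=.
  have : 0 <= \sum_(i < N - 2 | i != j) `|shift_pt p0.1 p0.2 i 0| by rewrite sumr_ge0.
  lra.
move=> n l a b ab bN hpi _.
have [j [hj ja jb hj0]] : exists j, [/\ (1 <= j <= N)%N, j != a, j != b &
    side (shifted_pt eps p0.1 p0.2 n) j != 0].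
  apply: contrapT => nex; apply: (nondeg n); exists a, b; split=> // k hk0 ka kb.
  apply/eqP; apply: contrapT => /negP k0; apply: nex; by exists k.
exists j; split=> //.
have [h|h] := hd j n hj; first by rewrite h eqxx in hj0.
have jN : (j < N.+1)%N by rewrite ltnS; case/andP: hj.
have := hk (Ordinal jN) => /=.
rewrite /l; move: h; rewrite !shifted_ptE !sideD => h h'.
apply: (le_trans e1).
set x := side (lattice_pt eps n) j in h *.
set y0 := side _ j in h h'; set y := side _ j in h' *.
have := lerB_normD (x + y0) (- (y0 - y)).
rewrite (_ : x + y0 - (y0 - y) = x + y); last by ring.
rewrite normrN; lra.
Unshelve. all: by end_near. Qed.


(** The M-test on the set of all points that are tame with the same [d]: the majorant of
    [tame_dominated] is summable over the lattice. *)
Lemma tame_cvg (d : R) : 0 < d ->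
  (forall p : 'cV[R[i]^o]_(N - 2) * R[i]^o, tame d p.1 p.2 ->
     Theta_partial theta eps A p @[A --> totally] --> Theta theta eps p) /\
  (forall e : R, 0 < e -> \forall A \near totally,
     forall p : 'cV[R[i]^o]_(N - 2) * R[i]^o, tame d p.1 p.2 ->
     `|Theta theta eps p - Theta_partial theta eps A p| < e%:C).
Proof.
move=> d0; have [C [r [C0 r01 hC]]] := tame_dominated d0.
have r0 : 0 <= r by case/andP: r01.
have [B hB] := int_vector_sum_bounded (N - 2) r01.
pose f (p : 'cV[R[i]^o]_(N - 2) * R[i]^o) := Theta_term theta eps p.1 p.2.
pose U := [set p : 'cV[R[i]^o]_(N - 2) * R[i]^o | tame d p.1 p.2].
pose g n := C * \prod_(j < N - 2) r ^+ absz (n j 0).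
have fg p n : U p -> `|f p n| <= (g n)%:C by exact: hC.
have g0 n : 0 <= g n by rewrite mulr_ge0 // prodr_ge0 // => j _; rewrite exprn_ge0.
have gB A : partial_sum g A <= C * B.
  by rewrite /partial_sum -mulr_sumr ler_wpM2l //; exact: hB.
split=> [p Up|e e0]; first exact: (dominated_cvg fg g0 gB).
exact: (dominated_cvg_unif fg g0 gB e0).
Qed.

End ThetaBound.

(** * Pointwise convergence on the half-space and compact convergence on the regular domain *)

Theorem theorem3p14 (R : realType) (N : nat) (theta eps : nat -> R)
    (hN : (5 <= N)%N)
    (htheta : forall k : nat, (1 <= k <= N)%N -> 0 < theta k < pi)
    (hsum : \sum_(1 <= k < N.+1) theta k = 2 * pi)
    (hrat : rational_angles N theta)
    (heps : lattice_normalized N theta eps) :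
  (forall (z : 'cV[R[i]^o]_(N - 2)) (tau : R[i]^o), 0 < complex.Im tau ->
     Theta_partial theta eps A (z, tau) @[A --> totally]
       --> Theta theta eps (z, tau)) /\
  {family compactly_in (regular_domain theta eps),
     Theta_partial theta eps A @[A --> totally]
       --> @Theta R N theta eps}.
Proof.
have [e0 [M hM _] _] := heps.
split=> [z tau v0|].
  have [d d0 td] := tame_point hN e0 hM z v0.
  by have [+ _] := tame_cvg hN htheta hsum e0 d0; apply.
apply/fam_cvgP => K [KD cK] P /uniform_nbhs[E [entE EP]].
have [[e e'] /=] : exists2 e : R[i], 0 < e &
    [set xy : R[i]^o * R[i]^o | ball xy.1 e xy.2] `<=` E.
  by move: entE; rewrite -entourage_ballE => -[e e0' sub]; exists e.
rewrite ltcE /= => /andP[/eqP -> e_gt0] ballE.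
suff : \forall A \near totally, K `<=` [set p |
    `|Theta theta eps p - Theta_partial theta eps A p| < e%:C].
  by apply: filterS => A hA; apply: EP => p /hA h; exact: ballE.
(* By compactness it suffices to find, near each point of [K], a neighbourhood on which the estimate
   holds for all large [A]; the points tame with a common [d] form one. *)
apply: (compact_near_coveringP K).1 => // p /KD p_reg.
have [d d0 td] := tame_near hN e0 hM p_reg.
have [_ /(_ e e_gt0) hunif] := tame_cvg hN htheta hsum e0 d0.
by exists ([set q | tame theta eps d q.1 q.2], [set A | forall q,
  tame theta eps d q.1 q.2 ->
  `|Theta theta eps q - Theta_partial theta eps A q| < e%:C]) => //;
  case=> q A /= [hq hA]; exact: hA.
Qed.
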